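(* Let $t > 1$ be a fixed integer, let $p(n,t)$ be the number of partitions of $n$ with difference $t$ between largest and smallest parts, and let $P_t(q) := \sum_{n\ge 1} p(n,t)\,q^n$. Then $P_t(q)$ is a rational function of $q$, and $p(n,t)$ is a quasipolynomial in $n$ of degree $t$ and period $\operatorname{lcm}(1,2,\dots,t)$.
   Context: A partition of a positive integer $n$ is an integer $k$-tuple $\lambda_1 \ge \lambda_2 \ge \dots \ge \lambda_k > 0$, for some $k\ge 1$, with $n = \lambda_1 + \dots + \lambda_k$; the $\lambda_i$ are its parts. For an integer $t \ge 0$, $p(n,t)$ denotes the number of partitions of $n$ with $\lambda_1 - \lambda_k = t$. A quasipolynomial is a function of the positive integer $n$ that evaluates to a polynomial when $n$ is restricted to a fixed residue class modulo some positive integer; the minimal such positive integer is called the period of the quasipolynomial. Its degree is the maximal degree of these polynomials. *)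

(* Defs.v *)
From mathcomp Require Import all_boot all_order all_algebra.

Set Implicit Arguments.
Unset Strict Implicit.
Unset Printing Implicit Defensive.

Import GRing.Theory Num.Theory.

Definition is_partition (n : nat) (l : seq nat) : bool :=
  [&& l != [::], sorted geq l, all (fun x => 0 < x) l & sumn l == n].

(* A partition of [n] has at most [n] parts, each at most [n], so the finite
   type [n.-bseq 'I_n.+1] contains each of them exactly once: see
   [partition_bseq] below ([map val] is injective on it). *)
Definition partitions_diff (n t : nat) : {set n.-bseq 'I_n.+1} :=
  [set s : n.-bseq 'I_n.+1 |
    is_partition n (map val s) &&
    (head 0 (map val s) == last 0 (map val s) + t)].

Definition p (n t : nat) : nat := #|partitions_diff n t|.

Lemma partition_bseq (n : nat) (l : seq nat) :
  is_partition n l -> exists s : n.-bseq 'I_n.+1, map val s = l.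
Proof.
case/and4P=> _ _ l_gt0 /eqP <-.
have size_le : size l <= sumn l.
  elim: l l_gt0 => //= x l IHl /andP[x_gt0 /IHl le_l].
  by rewrite -add1n leq_add.
have part_le x : x \in l -> x <= sumn l.
  move=> xl; rewrite (perm_sumn (perm_to_rem xl)) /=; exact: leq_addr.
have size_map_le : size (map (@inord (sumn l)) l) <= sumn l.
  by rewrite size_map.
exists (Bseq size_map_le) => /=.
rewrite -map_comp -[RHS]map_id; apply/eq_in_map => x xl /=.
by rewrite inordK // ltnS part_le.
Qed.

Local Open Scope ring_scope.

(* Formal power series are represented by their coefficient sequences;
   [a] is the series [\sum_(n >= 0) (a n) q^n]. *)
Definition P (t : nat) : nat -> rat :=
  fun n => if (1 <= n)%N then (p n t)%:R else 0.

(* [den * a = num] as formal power series in [q], with [den != 0]. *)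
Definition rational_series (a : nat -> rat) : Prop :=
  exists num den : {poly rat}, den != 0 /\
    forall n : nat, \sum_(i < n.+1) den`_i * a (n - i)%N = num`_n.

(* [c r], for [r < m], is the polynomial giving [f] on the positive integers
   congruent to [r] modulo [m]. *)
Definition constituents (f : nat -> rat) (m : nat) (c : nat -> {poly rat}) :
    Prop :=
  (0 < m)%N /\ forall n : nat, (0 < n)%N -> f n = (c (n %% m)%N).[n%:R].

Definition quasipolynomial (f : nat -> rat) : Prop :=
  exists m c, constituents f m c.

Definition quasi_period (f : nat -> rat) (d : nat) : Prop :=
  (exists c, constituents f d c) /\
  forall m c, constituents f m c -> (d <= m)%N.

Definition max_degree (m : nat) (c : nat -> {poly rat}) : nat :=
  \max_(r < m) (size (c r)).-1.

(* The choice of [m] and [c] is irrelevant: see [max_degree_uniq]. *)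
Definition quasi_degree (f : nat -> rat) (d : nat) : Prop :=
  exists m c, constituents f m c /\ max_degree m c = d.

Lemma max_degree_uniq (f : nat -> rat) m c m' c' :
  constituents f m c -> constituents f m' c' ->
  max_degree m c = max_degree m' c'.
Proof.
have agree m1 c1 m2 c2 : constituents f m1 c1 -> constituents f m2 c2 ->
    forall r, c1 (r %% m1)%N = c2 (r %% m2)%N.
  case=> m1_gt0 fc1 [m2_gt0 fc2] r.
  apply/eqP; rewrite -subr_eq0; apply/negPn/negP => nz.
  pose x k : rat := (r + k.+1 * (m1 * m2))%:R.
  have := max_poly_roots (rs := map x (iota 0 (size (c1 (r %% m1)%N -
            c2 (r %% m2)%N)))) nz.
  rewrite size_map size_iota ltnn => contra; suff: false by [].
  apply: contra.
    apply/allP => _ /mapP[k _ ->]; rewrite rootE hornerD hornerN subr_eq0.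
    have n_gt0 : (0 < r + k.+1 * (m1 * m2))%N.
      by rewrite addn_gt0 !muln_gt0 m1_gt0 m2_gt0 orbT.
    have := fc1 _ n_gt0; rewrite fc2 //.
    have -> : ((r + k.+1 * (m1 * m2)) %% m1 = r %% m1)%N.
      by rewrite [(m1 * m2)%N]mulnC mulnA addnC modnMDl.
    have -> : ((r + k.+1 * (m1 * m2)) %% m2 = r %% m2)%N.
      by rewrite mulnA addnC modnMDl.
    by move=> ->.
  rewrite map_inj_uniq ?iota_uniq // => k1 k2 /eqP.
  rewrite eqr_nat eqn_add2l eqn_pmul2r ?muln_gt0 ?m1_gt0 ?m2_gt0 //.
  by move=> /eqP[].
have le m1 c1 m2 c2 : constituents f m1 c1 -> constituents f m2 c2 ->
    (max_degree m1 c1 <= max_degree m2 c2)%N.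
  move=> fc1 fc2; apply/bigmax_leqP => r _.
  rewrite -(modn_small (ltn_ord r)) (agree _ _ _ _ fc1 fc2).
  have lt_m2 : (r %% m2 < m2)%N by rewrite ltn_mod; case: fc2.
  exact: (leq_bigmax (Ordinal lt_m2)).
by move=> fc fc'; apply/eqP; rewrite eqn_leq !le.
Qed.

(* Main.v *)
Require Import Defs.
From mathcomp Require Import all_boot all_order all_algebra.
From mathcomp Require Import all_field ring zify.

Set Implicit Arguments.
Unset Strict Implicit.
Unset Printing Implicit Defensive.

Import Order.TTheory GRing.Theory Num.Theory.

(** Sorting partitions by their smallest part [m] gives
    [P_t = \sum_(m >= 1) q^(2m+t) / (q^m; q)_(t+1)].  Since
    [q^m (1 - q^s) / (q^m; q)_(s+1) = 1 / (q^m; q)_s - 1 / (q^(m+1); q)_s],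
    summing by parts twice yields
    [P_t = q^(t-1) M / ((1 - q^(t-1)) (1 - q^t) (q^2; q)_(t-1))]
    with [M = (q; q)_t + q + ... + q^t - 1].
    The denominator divides [(1 - q^d)^(t+1)] with [d = lcm(1, ..., t)], which
    bounds the degree and the period from above.  They cannot be smaller since
    [M(1) = t - 1 <> 0], while at a primitive [i]-th root of unity [z] with
    [1 < i <= t] one has [(1 - z) M(z) = 2z - 1 - z^(t+1) <> 0], because
    [|z| = 1] and [z <> 1]. *)

(** * Counting partitions with parts in an interval *)

Section Counting.

(** Passing from bounded sequences to plain lists lets bijections be proved as [perm_eq] between
    duplicate-free lists. *)
Definition box (n : nat) (Q : pred (seq nat)) : seq (seq nat) :=
  [seq l <- [seq map val (s : n.-bseq 'I_n.+1) | s <- enum {: n.-bseq 'I_n.+1}]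
   | Q l].

Lemma size_box n Q :
  size (box n Q) = #|[set s : n.-bseq 'I_n.+1 | Q (map val s)]|.
Proof.
by rewrite /box filter_map size_map cardsE cardE {2}/enum_mem -enumT.
Qed.

Lemma box_uniq n Q : uniq (box n Q).
Proof.
apply: filter_uniq; rewrite map_inj_uniq ?enum_uniq //.
by move=> s1 s2 /(inj_map val_inj) /val_inj.
Qed.

(** Positive entries with sum [n] number at most [n] and are each at most [n], so the finite type
    misses no list satisfying [Q]. *)
Lemma mem_box n (Q : pred (seq nat)) :
  (forall l, Q l -> sumn l = n /\ all (leq 1) l) ->
  forall l, (l \in box n Q) = Q l.
Proof.
move=> Qn l; rewrite mem_filter; case Ql: (Q l) => //=; apply/mapP.
have [<- l_gt0] := Qn _ Ql.
have size_le : size l <= sumn l.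
  by elim: l l_gt0 {Ql} => //= x l IHl /andP[x_gt0 /IHl]; lia.
have part_le x : x \in l -> x <= sumn l.
  by move=> xl; rewrite (perm_sumn (perm_to_rem xl)) /=; exact: leq_addr.
have size_map_le : size (map (@inord (sumn l)) l) <= sumn l by rewrite size_map.
exists (Bseq size_map_le); rewrite ?mem_enum //= -map_comp -[LHS]map_id.
by apply/eq_in_map => x xl /=; rewrite inordK // ltnS part_le.
Qed.

Definition part_in (m s n : nat) (l : seq nat) : bool :=
  [&& sorted geq l, all (fun x => m <= x < m + s) l & sumn l == n].

Definition npart (m s n : nat) : nat := size (box n (part_in m s n)).

Lemma mem_part m s n l :
  0 < m -> (l \in box n (part_in m s n)) = part_in m s n l.
Proof.
move=> m_gt0; apply: mem_box => {}l /and3P[_ /allP l_in /eqP ->]; split=> //.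
by apply/allP => x /l_in; lia.
Qed.

(** Either the largest admissible part [m + s] is absent, or it heads the list and one copy of it
    can be removed. *)
Lemma npart_rec m s n : 0 < m ->
  npart m s.+1 n =
    npart m s n + (if m + s <= n then npart m s.+1 (n - (m + s)) else 0).
Proof.
move=> m_gt0.
pose B := if m + s <= n then
  box (n - (m + s)) (part_in m s.+1 (n - (m + s))) else [::].
suff : perm_eq (box n (part_in m s.+1 n))
         (box n (part_in m s n) ++ map (cons (m + s)) B).
  by rewrite /npart => /perm_size->; rewrite size_cat size_map /B; case: ifP.
have inB l : (l \in B) = (m + s <= n) && part_in m s.+1 (n - (m + s)) l.
  by rewrite /B; case: ifP => //; rewrite mem_part.
apply: uniq_perm; first exact: box_uniq.
  rewrite cat_uniq box_uniq map_inj_uniq => [|x y []//].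
  rewrite /B; case: ifP; rewrite ?box_uniq ?andbT //= => _.
  apply/hasPn => _ /mapP[l _ ->]; rewrite mem_part //.
  by rewrite /part_in /=; apply/negP => /and3P[_ /andP[] ]; lia.
move=> l; rewrite mem_cat !mem_part //; apply/idP/orP.
  move=> /and3P[sl al /eqP sm].
  case: l sl al sm => [|x l] sl al sm; first by left; rewrite /part_in /= -sm.
  have /= /andP[/andP[lex ltx] al'] := al.
  have ple : all (geq x) l.
    by apply: order_path_min sl => y z w /=; lia.
  have [xE|xN] := eqVneq x (m + s).
    right; apply/mapP; exists l; rewrite ?xE // inB /part_in (path_sorted sl) al'.
    by move: sm => /=; lia.
  left; rewrite /part_in sl sm eqxx andbT /=; apply/andP; split; first lia.
  by apply/allP => y yl; have := allP ple _ yl; have := allP al' _ yl => /=; lia.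
case=> [/and3P[sl /allP al sm]|/mapP[l' ]].
  by rewrite /part_in sl sm andbT; apply/allP => x /al; lia.
rewrite inB => /andP[len /and3P[sl al sm]] ->; apply/and3P; split=> /=.
- rewrite path_min_sorted //.
  by apply/allP => x /(allP al) /=; lia.
- by rewrite al andbT; lia.
- by lia.
Qed.

Lemma npart0 m n : 0 < m -> npart m 0 n = (n == 0).
Proof.
move=> m_gt0; suff : perm_eq (box n (part_in m 0 n)) (nseq (n == 0) [::]).
  by rewrite /npart => /perm_size->; rewrite size_nseq.
apply: uniq_perm; first exact: box_uniq.
  by case: (n == 0).
move=> l; rewrite mem_part // /part_in mem_nseq.
case: l => [|x l] /=; first by case: n.
by rewrite andbF; case: (x < _) / idP; lia.
Qed.

Lemma npart_small m s n : 0 < m -> n < m -> npart m s n = (n == 0).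
Proof.
move=> m_gt0 ltnm; elim: s => [|s IHs]; first exact: npart0.
by rewrite npart_rec // IHs ifN ?addn0 // -ltnNge; lia.
Qed.

(** Removing the largest part [m + t] and one copy of the smallest part [m] leaves an arbitrary,
    possibly empty, partition into parts between [m] and [m + t]. *)
Lemma p_npart n t : 0 < t ->
  p n t = \sum_(1 <= m < n.+1)
    (if m.*2 + t <= n then npart m t.+1 (n - (m.*2 + t)) else 0).
Proof.
move=> t_gt0.
pose Q l := is_partition n l && (head 0 l == last 0 l + t).
have -> : p n t = size (box n Q) by rewrite size_box.
pose B m := if m.*2 + t <= n then
  box (n - (m.*2 + t)) (part_in m t.+1 (n - (m.*2 + t))) else [::].
have inB m l : 0 < m -> (l \in B m) =
    (m.*2 + t <= n) && part_in m t.+1 (n - (m.*2 + t)) l.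
  by move=> m_gt0; rewrite /B; case: ifP => //; rewrite mem_part.
pose L := [seq m + t :: rcons l m | m <- iota 1 n, l <- B m].
suff /perm_size-> : perm_eq (box n Q) L.
  rewrite size_allpairs_dep sumnE big_map /index_iota subn1 /=.
  by apply: eq_bigr => m _; rewrite /B; case: ifP.
apply: uniq_perm; first exact: box_uniq.
  apply: allpairs_uniq_dep; rewrite ?iota_uniq //.
    by move=> m _; rewrite /B; case: ifP; rewrite ?box_uniq.
  (* Injectivity: [m] is recovered as the last entry. *)
  move=> [m1 l1] [m2 l2] _ _ /= [] _ /eqP.
  by rewrite eqseq_rcons => /andP[/eqP-> /eqP->].
move=> l; rewrite mem_box; last first.
  by move=> {}l /andP[/and4P[_ _ al /eqP ->]].
apply/idP/allpairsPdep.
  move=> /andP[/and4P[]].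
  case: l => // x l _ sl al /eqP sm /eqP hl.
  (* A single part would force [t = 0], so the first and last entries can be removed separately. *)
  case/lastP: l sl al sm hl => [|l m] sl al sm; rewrite /= ?last_rcons; first lia.
  move=> hx; exists m, l.
  move: al; rewrite /= all_rcons => /and3P[x_gt0 m_gt0 al].
  move: sm; rewrite /= sumn_rcons => sm.
  have tr : transitive geq by move=> ? ? ? /=; lia.
  have gx : all (geq x) l.
    move: sl; rewrite /= rcons_path => /andP[sl _].
    exact: (order_path_min tr sl).
  have gm : all (leq m) l.
    move: (sl); rewrite /= => /path_sorted.
    rewrite -rev_sorted rev_rcons /= => sr.
    have := order_path_min (leT := leq) leq_trans.
    by move=> /(_ m (rev l)); rewrite all_rev; apply.
  split; [by rewrite mem_iota; lia | | by rewrite hx].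
  rewrite inB // /part_in; apply/and4P; split; try lia.
    by move: sl => /path_sorted; rewrite -cats1 => /cat_sorted2[].
  apply/allP => y yl; have := allP gx _ yl; have := allP gm _ yl => /=; lia.
case=> m [l' []]; rewrite mem_iota => m_in.
rewrite inB; last lia.
move=> /andP[len /and3P[sl al /eqP sm]] ->.
apply/andP; split; last by rewrite /= last_rcons.
apply/and4P; split=> //=.
- rewrite -cats1 cat_path /= andbT; apply/andP; split.
    rewrite path_min_sorted //.
    by apply/allP => y /(allP al) /=; lia.
  have: last (m + t) l' \in m + t :: l' by exact: mem_last.
  by rewrite inE => /orP[/eqP->|/(allP al)] /=; lia.
- rewrite all_rcons; apply/and3P; split; try lia.
  by apply/allP => y /(allP al) /=; lia.
- by rewrite sumn_rcons sm; lia.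
Qed.

End Counting.

(** * Power series as coefficient sequences, and congruences modulo ['X^N] *)

Section Series.

Local Open Scope ring_scope.

(* The coefficients of the product of [g] and the power series [a]. *)
Definition act (R : nzRingType) (g : {poly R}) (a : nat -> R) (n : nat) : R :=
  \sum_(i < n.+1) g`_i * a (n - i)%N.

Lemma act_poly (R : nzRingType) (g u : {poly R}) n :
  act g (nth 0 u) n = (g * u)`_n.
Proof. by rewrite coefM. Qed.

Lemma eq_act (R : nzRingType) (g : {poly R}) (a b : nat -> R) n :
  (forall i, (i <= n)%N -> a i = b i) -> act g a n = act g b n.
Proof. by move=> ab; apply: eq_bigr => i _; rewrite ab // leq_subr. Qed.

(** The coefficient at [n] only sees [a] up to [n]; this turns series identities into polynomial
    ones. *)
Lemma act_trunc (R : nzRingType) (g : {poly R}) (a : nat -> R) N n :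
  (n < N)%N -> act g a n = (g * \poly_(i < N) a i)`_n.
Proof.
move=> ltnN; rewrite -act_poly; apply: eq_act => i lein.
by rewrite coef_poly ifT //; lia.
Qed.

Lemma actM (R : nzRingType) (g h : {poly R}) (a : nat -> R) n :
  act (g * h) a n = act g (act h a) n.
Proof.
rewrite (@act_trunc _ _ _ n.+1) // -mulrA -act_poly; apply: eq_act => i lein.
by rewrite -act_trunc.
Qed.

Lemma act_1BXn (R : nzRingType) k (a : nat -> R) n : (0 < k)%N ->
  act (1 - 'X^k) a n = a n - (if (k <= n)%N then a (n - k)%N else 0).
Proof.
move=> k_gt0; rewrite (@act_trunc _ _ _ n.+1) // mulrBl mul1r coefB coefXnM.
rewrite !coef_poly ltnSn; case: ltnP => //; rewrite ?subr0 // => _.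
by rewrite ifT //; lia.
Qed.

Lemma dvdpB (R : fieldType) (d u v : {poly R}) : d %| u -> d %| v -> d %| u - v.
Proof. by move=> du dv; rewrite dvdp_add ?dvdpNr. Qed.

(** Truncated series identities are stated below as divisibility by ['X^N], so that they combine
    linearly by [ring]. *)
Lemma dvdXnP (R : fieldType) (u : {poly R}) N :
  reflect (forall n, (n < N)%N -> u`_n = 0) ('X^N %| u).
Proof.
apply: (iffP idP) => [|u0].
  case/dvdpP => v -> n ltnN.
  by rewrite coefMXn ltnN.
rewrite -(poly_take_drop N u) (_ : take_poly N u = 0) ?add0r ?dvdp_mulIr //.
by apply/polyP => i; rewrite coef_take_poly coef0; case: ifP => // /u0.
Qed.

(* The series [1 / (q^m; q)_s] truncated modulo [q^N]. *)
Definition npoly N m s : {poly rat} := \poly_(i < N) (npart m s i)%:R.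

Lemma npoly_rec N m s : (0 < m)%N ->
  'X^N %| (1 - 'X^(m + s)) * npoly N m s.+1 - npoly N m s.
Proof.
move=> m_gt0; apply/dvdXnP => n ltnN; rewrite coefB coef_poly ltnN.
rewrite -act_trunc // act_1BXn ?addn_gt0 ?m_gt0 //.
rewrite npart_rec // natrD.
by case: ifP => _; rewrite ?subr0 ?addr0 ?addrK subrr.
Qed.

(** No nonempty partition survives the truncation, as every part is at least [N]. This supplies the
    far end of the telescoping sum. *)
Lemma npoly_large N m s : (0 < m)%N -> (N <= m)%N -> (0 < N)%N -> npoly N m s = 1.
Proof.
move=> m_gt0 leNm N_gt0; apply/polyP => n; rewrite coef_poly coef1.
case: ltnP => ltnN; last by case: n ltnN => //; lia.
by rewrite npart_small //; exact: leq_trans leNm.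
Qed.

Lemma npoly0 N m : (0 < m)%N -> (0 < N)%N -> npoly N m 0 = 1.
Proof.
move=> m_gt0 N_gt0; apply/polyP => n; rewrite coef_poly coef1 npart0 //.
by case: ltnP => //; case: n => //; lia.
Qed.

Lemma npoly_prod N m s : (0 < m)%N -> (0 < N)%N ->
  'X^N %| (\prod_(j < s) (1 - 'X^(m + j))) * npoly N m s - 1.
Proof.
move=> m_gt0 N_gt0; elim: s => [|s IHs].
  by rewrite big_ord0 npoly0 // mul1r subrr dvdp0.
rewrite big_ord_recr /=; set q := \prod_(i < s) _ in IHs *.
rewrite (_ : _ - 1 = q * ((1 - 'X^(m + s)) * npoly N m s.+1 - npoly N m s)
                   + (q * npoly N m s - 1)); last by ring.
by rewrite dvdp_add // dvdp_mull // npoly_rec.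
Qed.

(** The constant term is 1; by Gauss, such factors may be cancelled or introduced in congruences
    modulo ['X^N]. *)
Lemma coprime_1BXn (k N : nat) : (0 < k)%N -> coprimep 'X^N (1 - 'X^k : {poly rat}).
Proof.
move=> k_gt0; apply: coprimep_expl; rewrite coprimep_sym coprimepX rootE.
by rewrite !hornerE expr0n gtn_eqF // subr0 oner_eq0.
Qed.

(* Both sides become 1 after multiplication by [(X^(m+1); X)_s]. *)
Lemma npoly_rec_low N m s : (0 < m)%N ->
  'X^N %| (1 - 'X^m) * npoly N m s.+1 - npoly N m.+1 s.
Proof.
move=> m_gt0; case: N => [|N]; first exact: dvd1p.
pose q : {poly rat} := \prod_(j < s) (1 - 'X^(m.+1 + j)).
have cq : coprimep 'X^(N.+1) q.
  rewrite coprimep_sym; rewrite /q.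
  apply: (big_ind (fun u => coprimep u _)) => [|u v cu cv|j _].
  - exact: coprime1p.
  - by rewrite coprimepMl cu.
  - by rewrite coprimep_sym coprime_1BXn.
rewrite -(Gauss_dvdpr _ cq).
have := npoly_prod s.+1 m_gt0 (ltn0Sn N); rewrite big_ord_recl /= addn0.
rewrite (_ : \prod_(i < s) _ = q); last first.
  by apply: eq_bigr => i _; rewrite /bump /= add1n addnS.
move=> d1; have d2 := npoly_prod s (ltn0Sn m) (ltn0Sn N); rewrite -/q in d2.
rewrite [X in _ %| X](_ : _ = (1 - 'X^m) * q * npoly N.+1 m s.+1 - 1 -
    (q * npoly N.+1 m.+1 s - 1)).
  by rewrite dvdpB.
ring.
Qed.

(** Subtract the recurrence for the smallest part from that for the largest one: [(1 - 'X^(m + s)) -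
    (1 - 'X^m) = 'X^m * (1 - 'X^s)]. *)
Lemma npoly_telescope N m s : (0 < m)%N ->
  'X^N %| 'X^m * (1 - 'X^s) * npoly N m s.+1 - (npoly N m s - npoly N m.+1 s).
Proof.
move=> m_gt0; have d1 := npoly_rec N s m_gt0; have d2 := npoly_rec_low N s m_gt0.
rewrite [X in _ %| X](_ : _ = (1 - 'X^(m + s)) * npoly N m s.+1 - npoly N m s -
   ((1 - 'X^m) * npoly N m s.+1 - npoly N m.+1 s)); first by rewrite dvdpB.
rewrite exprD; ring.
Qed.

Lemma npoly_sum N s : (0 < N)%N ->
  'X^N %| (1 - 'X^s) * (\sum_(1 <= m < N.+1) 'X^m * npoly N m s.+1) -
    (npoly N 1 s - 1).
Proof.
move=> N_gt0; rewrite -{2}(@npoly_large N N.+1 s) // mulr_sumr.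
have -> : npoly N 1 s - npoly N N.+1 s =
    \sum_(1 <= m < N.+1) (npoly N m s - npoly N m.+1 s).
  rewrite -opprB -(telescope_sumr (fun m => npoly N m s)) // -sumrN.
  by apply: eq_bigr => i _; rewrite opprB.
rewrite -sumrB big_nat.
apply: (big_ind (fun u => 'X^N %| u)) => [|u v|m]; first exact: dvdp0.
  exact: dvdp_add.
by move=> /andP[m_gt0 _]; rewrite mulrA [X in X * _]mulrC npoly_telescope.
Qed.

(** * The generating function as a quotient of polynomials *)

Definition pser (t : nat) : nat -> rat := fun n => (p n t)%:R.

(* [qfac t = (q; q)_t] and [qfac' t = (q^2; q)_(t-1)]. *)
Definition qfac t : {poly rat} := \prod_(1 <= j < t.+1) (1 - 'X^j).
Definition qfac' t : {poly rat} := \prod_(2 <= j < t.+1) (1 - 'X^j).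
Definition den t : {poly rat} := (1 - 'X^(t.-1)) * (1 - 'X^t) * qfac' t.
Definition core t : {poly rat} := qfac t + \sum_(1 <= j < t.+1) 'X^j - 1.
Definition num t : {poly rat} := 'X^(t.-1) * core t.

Lemma qfacE t : (0 < t)%N -> qfac t = (1 - 'X) * qfac' t.
Proof. by move=> t_gt0; rewrite /qfac big_ltn. Qed.

Lemma core_1BX t : (1 - 'X) * core t = (1 - 'X) * qfac t - 1 + 'X *+ 2 - 'X^(t.+1).
Proof.
have e : (1 - 'X) * (\sum_(1 <= j < t.+1) 'X^j) = 'X - 'X^(t.+1) :> {poly rat}.
  elim: t => [|t IHt]; first by rewrite big_geq // mulr0 subrr.
  by rewrite big_nat_recr //= mulrDr IHt (exprS _ t.+1); ring.
by rewrite /core !(mulrDr, mulrBr) e; ring.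
Qed.

Lemma pser_npoly t N : (0 < t)%N ->
  'X^N %| (\poly_(i < N) pser t i) -
     'X^t * \sum_(1 <= m < N.+1) 'X^m * 'X^m * npoly N m t.+1.
Proof.
move=> t_gt0; apply/dvdXnP => n ltnN; rewrite coefB coef_poly ltnN.
rewrite /pser p_npart // natr_sum mulr_sumr coef_sum.
apply/eqP; rewrite subr_eq0; apply/eqP.
(* Terms with [m > n] carry the factor ['X^(t + 2m)] and contribute nothing in degree [n]. *)
rewrite (@big_cat_nat _ _ _ n.+1 1 N.+1) //=; last by lia.
rewrite [X in _ = _ + X]big_nat [X in _ = _ + X]big1 ?addr0; last first.
  move=> m m_in; rewrite mulrA -!exprD coefXnM ifT //; lia.
apply: eq_bigr => m _; rewrite mulrA -!exprD coefXnM coef_poly.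
have -> : (t + (m + m))%N = (m.*2 + t)%N by lia.
by case: leqP => // ?; rewrite ifT //; lia.
Qed.

Lemma den_pser_poly t N : (1 < t)%N ->
  'X^N %| den t * (\poly_(i < N) pser t i) - num t.
Proof.
(* From here on [s] is the given difference and [t] is [s - 2]. *)
case: t => [//|[//|t]] _; set s := t.+2.
case: N => [|N']; first exact: dvd1p.
set N := N'.+1; set F := \poly_(i < N) _.
pose S : {poly rat} := \sum_(1 <= m < N.+1) 'X^m * npoly N m s.
pose G : {poly rat} := \sum_(1 <= m < N.+1) 'X^m * 'X^m * npoly N m s.+1.
have dF : 'X^N %| F - 'X^s * G by exact: pser_npoly.
have dS : 'X^N %| (1 - 'X^(t.+1)) * S - (npoly N 1 t.+1 - 1) by exact: npoly_sum.
(* Second summation by parts: the telescoping identity weighted by ['X^m] gives [S - S'], and a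
   shift of the index expresses ['X * S'] through [S] and its first term. *)
have dG : 'X^N %| (1 - 'X^s) * ('X * G) - ('X * npoly N 1 s - (1 - 'X) * S).
  pose S' : {poly rat} := \sum_(1 <= m < N.+1) 'X^m * npoly N m.+1 s.
  have dG1 : 'X^N %| (1 - 'X^s) * G - (S - S').
    rewrite /G /S /S' -sumrB mulr_sumr -sumrB big_nat.
    apply: (big_ind (fun u => 'X^N %| u)) => [|u v|m]; [exact: dvdp0|exact: dvdp_add|].
    move=> /andP[m_gt0 _]; have := npoly_telescope N s m_gt0 => /(dvdp_mull 'X^m).
    by congr (_ %| _); ring.
  have dS' : 'X^N %| 'X * S' - (S - 'X * npoly N 1 s).
    have -> : 'X * S' = \sum_(2 <= m < N.+2) 'X^m * npoly N m s.
      rewrite big_add1 mulr_sumr; apply: eq_bigr => m _.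
      by rewrite exprS mulrA.
    have -> : S = 'X * npoly N 1 s + \sum_(2 <= m < N.+1) 'X^m * npoly N m s.
      by rewrite /S big_ltn.
    rewrite big_nat_recr //=.
    set B := (\sum_(2 <= m < _) _).
    (* Only the extra term [m = N + 1] of the shifted sum remains. *)
    rewrite [X in _ %| X](_ : _ = 'X^N * ('X * npoly N N.+1 s)).
      by rewrite dvdp_mulIl.
    by rewrite exprS; ring.
  rewrite [X in _ %| X](_ : _ = 'X * ((1 - 'X^s) * G - (S - S')) -
      ('X * S' - (S - 'X * npoly N 1 s))); last by ring.
  by rewrite dvdpB // dvdp_mull.
have dQ1 : 'X^N %| qfac s * npoly N 1 s - 1.
  have := npoly_prod s (ltn0Sn 0) (ltn0Sn N').
  by rewrite (_ : \prod_(j < s) _ = qfac s) // /qfac big_add1 big_mkord.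
have dQ2 : 'X^N %| qfac s * npoly N 1 t.+1 - (1 - 'X^s).
  have := npoly_prod t.+1 (ltn0Sn 0) (ltn0Sn N') => /(dvdp_mull (1 - 'X^s)).
  congr (_ %| _); rewrite mulrBr mulr1 mulrA; congr (_ * _ - _).
  by rewrite /qfac big_nat_recr //= big_add1 big_mkord mulrC.
have c1 : coprimep 'X^N (1 - 'X : {poly rat}).
  by rewrite -[X in 1 - X]expr1 coprime_1BXn.
(* Multiplying by [1 - 'X] replaces the sum inside [core] by a closed form. *)
rewrite -(Gauss_dvdpr _ c1) mulrBr /num [X in _ - X]mulrCA core_1BX.
have -> : (1 - 'X) * (den s * F) = (1 - 'X^(t.+1)) * (1 - 'X^s) * qfac s * F.
  by rewrite /den qfacE //=; ring.
rewrite [s.-1]/=.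
have Xs : 'X^s = 'X * 'X^(t.+1) :> {poly rat} by rewrite /s exprS.
have Xs1 : 'X^(s.+1) = 'X * 'X * 'X^(t.+1) :> {poly rat} by rewrite exprS Xs mulrA.
rewrite !Xs1 !Xs in dF dG dQ2 *.
move: dF dS dG dQ1 dQ2.
move: (npoly N 1 s) (npoly N 1 t.+1) (qfac s) (S) (G) (F).
move: ('X^(t.+1) : {poly rat}) => x h1 h2 q S1 G1 F1 dF dS dG dQ1 dQ2.
(* The first term trades [F1] for [G1]; the other multipliers are chosen so that [G1], [S1], [h1]
   and [h2] cancel. *)
rewrite [X in _ %| X](_ : _ = (1 - x) * (1 - 'X * x) * q * (F1 - 'X * x * G1)
   + (1 - x) * q * x * ((1 - 'X * x) * ('X * G1) - ('X * h1 - (1 - 'X) * S1))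
   - x * q * (1 - 'X) * ((1 - x) * S1 - (h2 - 1))
   + x * (1 - x) * 'X * (q * h1 - 1)
   - x * (1 - 'X) * (q * h2 - (1 - 'X * x))); last by ring.
by apply: dvdpB; [apply: dvdp_add; [apply: dvdpB; [apply: dvdp_add|]|]|]; exact: dvdp_mull.
Qed.

Lemma den_pser t n : (1 < t)%N -> act (den t) (pser t) n = (num t)`_n.
Proof.
move=> t_gt1; rewrite (@act_trunc _ _ _ n.+1) //.
apply/eqP; rewrite -subr_eq0 -coefB.
by have /dvdXnP/(_ n (ltnSn n))-> := den_pser_poly n.+1 t_gt1.
Qed.

End Series.

(** * Finite differences of step [m] and quasipolynomials *)

Section Differences.

Local Open Scope ring_scope.

Definition fdiff (m : nat) (a : nat -> rat) (n : nat) : rat :=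
  a (n + m)%N - a n.

(** Each factor [1 - 'X^m] is a backward difference; starting [m * k] further on makes it a forward
    one and keeps all indices nonnegative. *)
Lemma act_fdiff k m a n : (0 < m)%N ->
  act ((1 - 'X^m) ^+ k) a (n + m * k)%N = iter k (fdiff m) a n.
Proof.
move=> m_gt0; elim: k n => [|k IHk] n.
  by rewrite muln0 addn0 expr0 (@act_trunc _ _ _ n.+1) // mul1r coef_poly ltnSn.
rewrite exprS actM act_1BXn // ifT; last by lia.
rewrite (_ : n + m * k.+1 - m = n + m * k)%N; last by lia.
by rewrite (_ : n + m * k.+1 = n + m + m * k)%N ?IHk //; lia.
Qed.

(** Newton's forward difference formula along a progression of step [m]; the induction on [j] is
    Pascal's rule. *)
Lemma newton K m a : (forall n, iter K (fdiff m) a n = 0) ->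
  forall r j, a (r + j * m)%N = \sum_(i < K) 'C(j, i)%:R * iter i (fdiff m) a r.
Proof.
elim: K a => [|K IHK] a aK r j; first by rewrite big_ord0; exact: aK.
have {}IHK := IHK (fdiff m a) _ r; elim: j => [|j IHj].
  rewrite addn0 big_ord_recl /= mul1r big1 ?addr0 // => i _.
  by rewrite bin0n mul0r.
have -> : a (r + j.+1 * m)%N = a (r + j * m)%N + fdiff m a (r + j * m)%N.
  by rewrite /fdiff addrCA subrr addr0 mulSn (addnC m) addnA.
rewrite IHK => [|n]; last by rewrite -iterSr.
rewrite IHj !big_ord_recl /= !bin0 -addrA -big_split /=; congr (_ + _).
by apply: eq_bigr => i _; rewrite -iterSr -mulrDl -natrD -binS.
Qed.

Definition binomial_poly i : {poly rat} := i`!%:R^-1 *: \prod_(l < i) ('X - (l%:R)%:P).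

Lemma size_binomial_poly i : (size (binomial_poly i) <= i.+1)%N.
Proof.
apply: leq_trans (size_scale_leq _ _) _.
by rewrite size_prod_XsubC /index_enum -enumT size_enum_ord.
Qed.

Lemma binomial_polyE i j : (binomial_poly i).[j%:R] = 'C(j, i)%:R.
Proof.
rewrite hornerZ horner_prod.
have -> : \prod_(l < i) ('X - (l%:R)%:P).[j%:R] = (j ^_ i)%:R :> rat.
  elim: i => [|i IHi]; first by rewrite big_ord0 ffactn0.
  rewrite big_ord_recr /= IHi ffactnSr hornerXsubC natrM.
  case: (leqP i j) => [leij|ltji]; first by rewrite natrB.
  by rewrite ffact_small // !mul0r.
by rewrite -bin_ffact natrM mulrC mulfK // pnatr_eq0 -lt0n fact_gt0.
Qed.

Lemma quasi_of_fdiff k m a : (0 < m)%N ->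
  (forall n, iter k.+1 (fdiff m) a n = 0) ->
  exists2 c : nat -> {poly rat}, forall n, a n = (c (n %% m)%N).[n%:R] &
    forall r, (size (c r) <= k.+1)%N.
Proof.
move=> m_gt0 ak.
(* Newton's formula is a polynomial in [j]; substitute [j = (n - r) / m]. *)
exists (fun r => (\sum_(i < k.+1) iter i (fdiff m) a r *: binomial_poly i) \Po
          (m%:R^-1 *: ('X - (r%:R)%:P))) => [n|r].
  rewrite horner_comp hornerZ hornerXsubC.
  have -> : m%:R^-1 * (n%:R - (n %% m)%:R) = (n %/ m)%:R :> rat.
    rewrite {1}(divn_eq n m) natrD addrK natrM mulrC mulfK //.
    by rewrite pnatr_eq0 -lt0n.
  rewrite {1}(divn_eq n m) addnC (newton ak) horner_sum.
  by apply: eq_bigr => i _; rewrite hornerZ binomial_polyE mulrC.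
set u := (\sum_(i < _) _); set v := _ *: _.
have su : (size u <= k.+1)%N.
  apply: leq_trans (size_sum _ _ _) _; apply/bigmax_leqP => i _.
  apply: leq_trans (size_scale_leq _ _) _.
  by apply: leq_trans (size_binomial_poly _) _.
have sv : (size v <= 2)%N.
  by apply: leq_trans (size_scale_leq _ _) _; rewrite size_XsubC.
apply: leq_trans (size_comp_poly_leq _ _) _; rewrite ltnS -[X in (_ <= X)%N]muln1.
by apply: leq_mul; rewrite -subn1 leq_subLR.
Qed.

(** A translation preserves the degree and the leading coefficient, so the top terms cancel. *)
Lemma size_shift_sub K (c : {poly rat}) (x : rat) :
  (size c <= K.+1)%N -> (size (c \Po ('X + x%:P) - c)%R <= K)%N.
Proof.
move=> sc; have s2 : size ('X + x%:P : {poly rat}) = 2 by exact: size_XaddC.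
have sS := size_comp_poly2 c s2.
have lS : lead_coef (c \Po ('X + x%:P)) = lead_coef c.
  by rewrite lead_coef_comp ?s2 // lead_coefXaddC expr1n mulr1.
apply/leq_sizeP => i leKi; rewrite coefB; apply/eqP; rewrite subr_eq0; apply/eqP.
have [le_si|lt_is] := leqP (size c) i; first by rewrite !nth_default ?sS.
have iE : i = (size c).-1 by lia.
by rewrite iE -{1}sS -!lead_coefE.
Qed.

(** A step of [m] stays in the same residue class, so each difference acts on every constituent
    separately and lowers its size bound by one. *)
Lemma fdiff_quasi K m f (c : nat -> {poly rat}) : (0 < m)%N ->
  (forall n, (0 < n)%N -> f n = (c (n %% m)%N).[n%:R]) ->
  (forall r, (r < m)%N -> (size (c r) <= K)%N) ->
  forall n, (0 < n)%N -> iter K (fdiff m) f n = 0.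
Proof.
move=> m_gt0; elim: K f c => [|K IHK] f c fc sc n n_gt0.
  have := sc _ (ltn_pmod n m_gt0); rewrite leqn0 size_poly_eq0 => /eqP c0.
  by rewrite /= fc // c0 horner0.
rewrite iterSr; apply: (IHK _ (fun r => c r \Po ('X + (m%:R)%:P) - c r)) => //.
  move=> j j_gt0; rewrite /fdiff !fc ?addn_gt0 ?j_gt0 // modnDr.
  by rewrite hornerD hornerN horner_comp !hornerE natrD.
by move=> r ltrm; apply: size_shift_sub; exact: sc.
Qed.

End Differences.

(** * Upper and lower bounds for the degree and the period *)

Section Main.

Local Open Scope ring_scope.

Lemma size_1BXn k : (0 < k)%N -> size (1 - 'X^k : {poly rat}) = k.+1.
Proof. by move=> k_gt0; rewrite -opprB size_polyN size_XnsubC. Qed.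

Lemma neq0_1BXn k : (0 < k)%N -> (1 - 'X^k : {poly rat}) != 0.
Proof. by move=> k_gt0; rewrite -size_poly_eq0 size_1BXn. Qed.

Lemma qfac'_neq0 t : qfac' t != 0.
Proof.
rewrite /qfac' big_nat prodf_seq_neq0; apply/allP => j _.
by apply/implyP => /andP[j_gt1 _]; rewrite neq0_1BXn //; exact: ltnW.
Qed.

Lemma size_den t : (1 < t)%N -> size (den t) = (t.-1 + t + size (qfac' t))%N.
Proof.
move=> t_gt1.
have n1 : (1 - 'X^(t.-1) : {poly rat}) != 0 by rewrite neq0_1BXn //; lia.
have n2 : (1 - 'X^t : {poly rat}) != 0 by rewrite neq0_1BXn //; lia.
rewrite /den !size_mul ?mulf_neq0 ?qfac'_neq0 // !size_1BXn; [|lia..].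
by rewrite addnS.
Qed.

Lemma den_neq0 t : (1 < t)%N -> den t != 0.
Proof. by move=> t_gt1; rewrite -size_poly_eq0 size_den //; lia. Qed.

(** The fraction is proper, so the quasipolynomial formula holds from the first coefficient on,
    without exceptional initial terms. *)
Lemma size_num_den t : (1 < t)%N -> (size (num t) < size (den t))%N.
Proof.
move=> t_gt1; have t_gt0 : (0 < t)%N by lia.
have q'0 : (0 < size (qfac' t))%N by rewrite size_poly_gt0 qfac'_neq0.
have sq : size (qfac t) = (size (qfac' t)).+1.
  rewrite qfacE // -[X in 1 - X]expr1 size_mul ?qfac'_neq0 ?neq0_1BXn //.
  by rewrite size_1BXn.
have ltq : (t.+1 <= size (qfac t))%N.
  rewrite -(size_1BXn t_gt0) dvdp_leq //.
    by rewrite -size_poly_eq0 sq.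
  by rewrite /qfac big_nat_recr //= dvdp_mulIr.
have sc : (size (core t) <= size (qfac t))%N.
  rewrite /core; apply: leq_trans (size_polyD _ _) _.
  rewrite geq_max size_polyN size_poly1; apply/andP; split; last by lia.
  apply: leq_trans (size_polyD _ _) _; rewrite geq_max leqnn /=.
  apply: leq_trans ltq; rewrite big_nat.
  apply: leq_trans (size_sum _ _ _) _; apply/bigmax_leqP_seq => j _ /andP[_ ltjt].
  by rewrite size_polyXn.
have c1 : (size (num t) <= t.-1 + size (core t))%N.
  by apply: leq_trans (size_polyMleq _ _) _; rewrite size_polyXn; lia.
by rewrite size_den //; lia.
Qed.

Lemma dvdp_1BXn (i d : nat) : (i %| d)%N -> (1 - 'X^i : {poly rat}) %| 1 - 'X^d.
Proof.
case/dvdnP => k ->; rewrite mulnC exprM -[X in _ %| X - _](expr1n _ k) subrXX.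
exact: dvdp_mulIl.
Qed.

(** There are [t + 1] factors [1 - 'X^i] in [den t], all with [0 < i <= t], and each divides
    [1 - 'X^d]. *)
Lemma den_dvd t d : (1 < t)%N -> (forall i, (0 < i <= t)%N -> (i %| d)%N) ->
  den t %| (1 - 'X^d) ^+ t.+1.
Proof.
move=> t_gt1 d_dvd; rewrite (_ : t.+1 = 1 + 1 + (t.+1 - 2))%N; last by lia.
rewrite !exprD expr1 /den; apply: dvdp_mul; first apply: dvdp_mul.
- by apply: dvdp_1BXn; apply: d_dvd; lia.
- by apply: dvdp_1BXn; apply: d_dvd; lia.
rewrite -prodr_const_nat /qfac' !big_nat.
apply: (big_ind2 (fun u v : {poly rat} => u %| v)) => // [|j /andP[j1 j2]].
  by move=> u1 u2 v1 v2; exact: dvdp_mul.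
by apply: dvdp_1BXn; apply: d_dvd; lia.
Qed.

(** With [g * den t = (1 - 'X^d) ^+ t.+1], the product of this power and the series is [g * num t],
    of degree below [d * t.+1]. Hence all differences of order [t + 1] vanish. *)
Lemma pser_constituents t d : (1 < t)%N -> (0 < d)%N ->
  (forall i, (0 < i <= t)%N -> (i %| d)%N) ->
  exists2 c, constituents (pser t) d c & forall r, (size (c r) <= t.+1)%N.
Proof.
move=> t_gt1 d_gt0 /(den_dvd t_gt1)/dvdpP[g gE].
have gnz : g != 0.
  apply/eqP => g0; move: gE; rewrite g0 mul0r => /eqP.
  by rewrite expf_eq0 (negPf (neq0_1BXn d_gt0)) andbF.
have [|c fc sc] := @quasi_of_fdiff t d (pser t) d_gt0.
  move=> n; rewrite -act_fdiff // gE actM.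
  rewrite (@eq_act _ _ _ (nth 0 (num t))) => [|i _]; last exact: den_pser.
  rewrite act_poly nth_default //.
  have s1 : size (g * den t) = (d * t.+1).+1.
    have s0 : (0 < size (g * den t)%R)%N.
      by rewrite size_poly_gt0 mulf_neq0 ?den_neq0.
    by rewrite -(prednK s0) -gE size_exp size_1BXn.
  have s2 := size_num_den t_gt1.
  rewrite size_mul ?den_neq0 // in s1.
  have g0 : (0 < size g)%N by rewrite size_poly_gt0.
  apply: leq_trans (size_polyMleq _ _) _; apply: leq_trans (leq_addl _ _).
  rewrite -ltnS -s1; move: s2 g0.
  by move: (size g) (size (num t)) (size (den t)) => a b k; lia.
by exists c => //; split.
Qed.

(** Conversely, size bounds on constituents make [(1 - 'X^m) ^+ K] times the series a polynomial;
    both lower bounds come from the resulting identity. *)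
Lemma constituents_num t m c K : (1 < t)%N -> constituents (pser t) m c ->
  (forall r, (r < m)%N -> (size (c r) <= K)%N) ->
  exists g, den t * g = (1 - 'X^m) ^+ K * num t.
Proof.
move=> t_gt1 [m_gt0 fc] sc; set G := (1 - 'X^m) ^+ K.
(* Degree [m * K] is kept: its coefficient is a difference at 0, where the constituents say
   nothing. *)
exists (\poly_(i < (m * K).+1) act G (pser t) i).
apply/polyP => n; rewrite -act_poly -[RHS]act_poly.
transitivity (act (den t) (act G (pser t)) n).
  apply: eq_act => i _; rewrite coef_poly; case: ltnP => // lti.
  rewrite -[in RHS](subnK (ltnW lti)) act_fdiff // (fdiff_quasi m_gt0 fc sc) //.
  by rewrite subn_gt0.
rewrite -actM mulrC actM.
by apply: eq_act => i _; rewrite den_pser.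
Qed.

(** Nonvanishing here means that the zero of [den t] at [z] is not cancelled by [num t]. *)
Lemma core_root t i (z : algC) : (1 < i <= t)%N -> i.-primitive_root z ->
  (map_poly ratr (core t)).[z] != 0.
Proof.
move=> /andP[i_gt1 leit] zi.
have z_neq1 : z != 1.
  by rewrite -[z]expr1 -(prim_order_dvd zi) dvdn1; lia.
apply/eqP => c0.
have q0 : (map_poly ratr (qfac t)).[z] = 0.
  have : (1 - 'X^i : {poly rat}) %| qfac t.
    rewrite /qfac (@big_cat_nat _ _ _ i) //=; [|lia|lia].
    by rewrite (@big_ltn _ _ _ i) ?ltnS // mulrCA dvdp_mulIl.
  case/dvdpP => w ->; rewrite rmorphM hornerM rmorphB rmorph1 /= map_polyXn.
  by rewrite !hornerE (prim_expr_order zi) subrr mulr0.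
move: (core_1BX t); move: (core t) (qfac t) c0 q0 => C Q c0 q0.
move/(congr1 (fun u => (map_poly ratr u).[z])).
rewrite !(rmorphM, rmorphD, rmorphN, rmorphMn, rmorph1) /= map_polyX map_polyXn.
rewrite !hornerE c0 q0 !mulr0 /= => e.
have z2 : z *+ 2 = 1 + z ^+ t.+1.
  by apply/eqP; rewrite -subr_eq0; apply/eqP; rewrite [RHS]e; ring.
have nz : `|z| = 1.
  apply/eqP; rewrite -(@pexpr_eq1 _ _ i) ?normr_ge0 //; last by lia.
  by rewrite -normrX (prim_expr_order zi) normr1.
(* Equality in the triangle inequality: [1] and [z ^+ t.+1] have modulus 1 and their sum [2z] has
   modulus 2, so they coincide and [z = 1]. *)
have [] := @normCDeq _ 1 (z ^+ t.+1).
  by rewrite -z2 normrMn nz normrX nz normr1 expr1n.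
move=> u _ []; rewrite normrX nz normr1 expr1n !mul1r => <- w1.
move: z2; rewrite w1 => /eqP; rewrite -[1 + 1]/(1 *+ 2) eqrMn2r //.
by rewrite (negPf z_neq1).
Qed.

(** Evaluate the identity of [constituents_num] at a primitive [i]-th root of unity [z]: [den t]
    vanishes and [num t] does not, so [z ^+ m = 1]. *)
Lemma constituents_dvd t m c i : (1 < t)%N -> constituents (pser t) m c ->
  (0 < i <= t)%N -> (i %| m)%N.
Proof.
move=> t_gt1 fc /andP[i_gt0 leit].
have [->|i_neq1] := eqVneq i 1%N; first exact: dvd1n.
have i_gt1 : (1 < i)%N by lia.
have [z zi] := C_prim_root_exists i_gt0.
have [|g gE] := @constituents_num t m c (\max_(r < m) size (c r)) t_gt1 fc.
  by move=> r ltrm; exact: (leq_bigmax (Ordinal ltrm)).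
have d0 : (map_poly ratr (den t)).[z] = 0.
  have : (1 - 'X^i : {poly rat}) %| den t.
    rewrite /den dvdp_mull // /qfac' (@big_cat_nat _ _ _ i) //=; last by lia.
    by rewrite (@big_ltn _ _ _ i) ?ltnS // mulrCA dvdp_mulIl.
  case/dvdpP => w ->; rewrite rmorphM hornerM rmorphB rmorph1 /= map_polyXn.
  by rewrite !hornerE (prim_expr_order zi) subrr mulr0.
have c0 : (map_poly ratr (core t)).[z] != 0.
  by apply: core_root zi; rewrite i_gt1.
move: gE; rewrite /num; move: (den t) (core t) d0 c0 => D C d0 c0.
move/(congr1 (fun u => (map_poly ratr u).[z])).
rewrite !(rmorphM, rmorphXn, rmorphB, rmorph1) /= !map_polyX.
rewrite !hornerE d0 mul0r => /esym/eqP; rewrite !mulf_eq0 (negPf c0) orbF.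
rewrite !expf_eq0; case/orP => /andP[_].
  by rewrite subr_eq0 eq_sym -(prim_order_dvd zi).
move=> /eqP z0; have := prim_expr_order zi.
by rewrite z0 expr0n gtn_eqF // => /eqP; rewrite eq_sym oner_eq0.
Qed.

(** The cofactor of [1 - 'X] in [1 - 'X^k]; being nonzero at 1 for [k > 0], it exposes the order of
    the zero there. *)
Definition geom k : {poly rat} := \sum_(i < k) 'X^i.

Lemma geomE k : 1 - 'X^k = (1 - 'X) * geom k.
Proof.
rewrite -[X in X - _](expr1n _ k) subrXX; congr (_ * _).
by apply: eq_bigr => i _; rewrite expr1n mul1r.
Qed.

Lemma geom1 k : (geom k).[1] = k%:R.
Proof.
rewrite horner_sum (eq_bigr (fun=> 1)) ?sumr_const ?card_ord // => i _.
by rewrite hornerXn expr1n.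
Qed.

Lemma core1 t : (0 < t)%N -> (core t).[1] = t.-1%:R.
Proof.
move=> t_gt0; rewrite /core qfacE // !hornerE horner_sum.
rewrite (eq_bigr (fun=> 1)) => [|j _]; last by rewrite hornerXn expr1n.
by rewrite sumr_const_nat subn1 /= -[in LHS](prednK t_gt0) -natr1 addrK.
Qed.

(** If all sizes were at most [t], the zero of order at least [t + 1] of [den t] at 1 would divide
    [(1 - 'X^m) ^+ t * num t]. Cancelling [(1 - 'X) ^+ t] and evaluating at 1 gives
    [m ^ t * (t - 1) = 0]. *)
Lemma constituents_degree t m c : (1 < t)%N -> constituents (pser t) m c ->
  ~~ [forall r : 'I_m, (size (c r) <= t)%N].
Proof.
move=> t_gt1 fc; apply/negP => /forallP sc.
have [|g] := @constituents_num t m c t t_gt1 fc.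
  by move=> r ltrm; exact: (sc (Ordinal ltrm)).
have [w wE] : exists w, den t = (1 - 'X) ^+ t.+1 * w.
  exists (geom t.-1 * geom t * \prod_(2 <= j < t.+1) geom j).
  rewrite /den !geomE /qfac' (eq_bigr (fun j => (1 - 'X) * geom j)); last first.
    by move=> j _; rewrite geomE.
  rewrite big_split /= prodr_const_nat (_ : t.+1 - 2 = t.-1)%N; last by lia.
  rewrite -[in X in _ = X * _](prednK (ltnW t_gt1)) !exprS; ring.
have m_gt0 : (0 < m)%N by case: fc.
rewrite wE geomE exprMn exprSr -!mulrA => /mulfI.
rewrite expf_eq0 -[X in 1 - X]expr1 (negPf (neq0_1BXn _)) // andbF => /(_ isT).
rewrite /num; move: (core t) (core1 (ltnW t_gt1)) => C C1.
move/(congr1 (fun u : {poly rat} => u.[1])); rewrite !hornerE /= C1 geom1.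
rewrite expr1n mulr1 => /esym/eqP.
rewrite mulf_eq0 expf_eq0 !pnatr_eq0; lia.
Qed.

(** * The least common multiple of [1, ..., t], and the conclusion *)

Lemma dvd_lcm_range t i : (0 < i <= t)%N -> (i %| \big[lcmn/1%N]_(1 <= j < t.+1) j)%N.
Proof.
elim: t => [|t IHt] i_in; first by lia.
rewrite big_nat_recr //=; have [->|ne] := eqVneq i t.+1; first exact: dvdn_lcmr.
by apply: dvdn_trans (dvdn_lcml _ _); apply: IHt; lia.
Qed.

Lemma lcm_range_dvd t m : (forall i, (0 < i <= t)%N -> (i %| m)%N) ->
  (\big[lcmn/1%N]_(1 <= j < t.+1) j %| m)%N.
Proof.
elim: t => [|t IHt] dm; first by rewrite big_geq ?dvd1n.
rewrite big_nat_recr //= dvdn_lcm IHt => [|i i_in]; last by apply: dm; lia.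
by apply: dm; lia.
Qed.

Lemma lcm_range_gt0 t : (0 < \big[lcmn/1%N]_(1 <= j < t.+1) j)%N.
Proof.
elim: t => [|t IHt]; first by rewrite big_geq.
by rewrite big_nat_recr //= lcmn_gt0 IHt.
Qed.

Lemma rational_P t : (1 < t)%N -> rational_series (P t).
Proof.
move=> t_gt1; exists (num t), (den t); split; first exact: den_neq0.
move=> n; rewrite -den_pser //; apply: (@eq_act _ (den t)) => i _.
(* The two sequences could differ only at index 0, where [p 0 t] is an empty sum. *)
rewrite /P /pser; case: i => //=.
by rewrite p_npart ?big_geq //; exact: ltnW.
Qed.

End Main.

Theorem mainTheorem2 (t : nat) (ht : 1 < t) :
  rational_series (P t) /\
  quasipolynomial (fun n : nat => ((p n t)%:R)%R) /\
  quasi_degree (fun n : nat => ((p n t)%:R)%R) t /\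
  quasi_period (fun n : nat => ((p n t)%:R)%R)
    (\big[lcmn/1]_(1 <= i < t.+1) i).
Proof.
have d_gt0 := lcm_range_gt0 t; set d := \big[lcmn/1]_(_ <= _ < _) _ in d_gt0 *.
have [c fc sc] := pser_constituents ht d_gt0 (@dvd_lcm_range t).
split; first exact: rational_P.
split; first by exists d, c.
split; last first.
  split; first by exists c.
  (* Minimality holds in the stronger form that [d] divides every admissible modulus. *)
  move=> m c' fc'; apply: dvdn_leq; first by case: fc'.
  by apply: lcm_range_dvd => i; exact: constituents_dvd fc'.
exists d, c; split=> //; apply/eqP; rewrite eqn_leq; apply/andP; split.
  by apply/bigmax_leqP => r _; have := sc r; lia.
(* Some constituent has size above [t], so the degree [t] is attained. *)
have /forallPn[r] := constituents_degree ht fc; rewrite -ltnNge => ltr.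
by apply: leq_trans (leq_bigmax r); lia.
Qed.
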